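(* Let $n\ge 1$, let $\mathcal W$ be the Walsh algebra of dimension $2^n$ over $\mathbb R$, and let $\widehat f\in\mathcal W$. If the roots of the characteristic polynomial of $\widehat f$ are strictly positive, then $\widehat f$ admits an exponential representation, i.e. there exists $\widehat g\in\mathcal W$ with $\widehat f=\exp\widehat g$.
   Context: The Walsh algebra is $\mathcal W=U_0\otimes\cdots\otimes U_{n-1}$, the tensor product over $\mathbb R$ of $n$ two-dimensional commutative associative unital real algebras $U_k$ with bases $\{\widehat 1_k,\widehat u_k\}$, $\widehat u_k^2=\widehat 1_k$ ($\widehat 1_k$ the unit). The characteristic polynomial of an element is the characteristic polynomial of the linear map ''multiplication by that element'' on $\mathcal W$; for elements of $\mathcal W$ all of its roots are real. The exponential is $\exp\widehat g=\sum_{k\ge0}\widehat g^{\,k}/k!$. *)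

(* Defs.v *)
From HB Require Import structures.
From mathcomp Require Import all_boot all_order all_algebra.
From mathcomp Require Import all_classical all_reals all_analysis.

Set Implicit Arguments.
Unset Strict Implicit.
Unset Printing Implicit Defensive.

Import Order.TTheory GRing.Theory Num.Theory.
Import numFieldNormedType.Exports.

Local Open Scope classical_set_scope.
Local Open Scope ring_scope.

(* The multi-index a stands for the pure tensor whose k-th factor is the
   basis vector 1_k of U_k if a k = false and u_k if a k = true. *)
Definition walsh_index (n : nat) := {ffun 'I_n -> bool}.

(* Index of the product of two such pure tensors, as u_k * u_k = 1_k. *)
Definition walsh_indexM n (a b : walsh_index n) : walsh_index n :=
  [ffun k => a k (+) b k].

Definition walsh_index1 n : walsh_index n := [ffun=> false].

(* Elements are row vectors of coordinates in the basis of pure tensors of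
   basis vectors; rows are used because they carry the vector space and
   finite-dimensional normed topology structures of the library. *)
Definition walsh (R : realType) (n : nat) : Type :=
  'rV[R]_#|{: walsh_index n}|.

HB.instance Definition _ (R : realType) n := NormedModule.on (walsh R n).
HB.instance Definition _ (R : realType) n := Complete.on (walsh R n).
HB.instance Definition _ (R : realType) n := Vector.on (walsh R n).

Definition walsh_coef (R : realType) n (x : walsh R n) (a : walsh_index n) : R :=
  x 0 (enum_rank a).

Definition walsh_basis (R : realType) n (a : walsh_index n) : walsh R n :=
  delta_mx 0 (enum_rank a).

Definition walsh_mul (R : realType) n (x y : walsh R n) : walsh R n :=
  \sum_a \sum_b
    (walsh_coef x a * walsh_coef y b) *: walsh_basis R (walsh_indexM a b).

Section WalshAlgebra.
Variables (R : realType) (n : nat).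
Implicit Types (x y z : walsh R n) (a b c : walsh_index n).

Lemma card_walsh_index : #|{: walsh_index n}| = (2 ^ n)%N.
Proof. by rewrite card_ffun card_bool card_ord. Qed.

Lemma walsh_indexMC a b : walsh_indexM a b = walsh_indexM b a.
Proof. by apply/ffunP => k; rewrite !ffunE addbC. Qed.

Lemma walsh_indexMA a b c :
  walsh_indexM a (walsh_indexM b c) = walsh_indexM (walsh_indexM a b) c.
Proof. by apply/ffunP => k; rewrite !ffunE addbA. Qed.

Lemma walsh_indexMK a : involutive (walsh_indexM a).
Proof. by move=> b; apply/ffunP => k; rewrite !ffunE addKb. Qed.

Lemma walsh_index1M a : walsh_indexM (walsh_index1 n) a = a.
Proof. by apply/ffunP => k; rewrite !ffunE. Qed.

Lemma walsh_coefP x y : walsh_coef x =1 walsh_coef y -> x = y.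
Proof.
move=> xy; apply/rowP => i.
by have := xy (enum_val i); rewrite /walsh_coef enum_valK.
Qed.

Lemma walsh_coefD x y a : walsh_coef (x + y) a = walsh_coef x a + walsh_coef y a.
Proof. by rewrite /walsh_coef mxE. Qed.

Lemma walsh_coefZ (r : R) x a : walsh_coef (r *: x) a = r * walsh_coef x a.
Proof. by rewrite /walsh_coef mxE. Qed.

Lemma walsh_coef_sum (I : finType) (F : I -> walsh R n) a :
  walsh_coef (\sum_i F i) a = \sum_i walsh_coef (F i) a.
Proof. by rewrite /walsh_coef summxE. Qed.

Lemma walsh_coef_basis a b : walsh_coef (walsh_basis R a) b = (b == a)%:R.
Proof. by rewrite /walsh_coef mxE eqxx (inj_eq enum_rank_inj). Qed.

Lemma walsh_coefM x y c :
  walsh_coef (walsh_mul x y) c =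
  \sum_a walsh_coef x a * walsh_coef y (walsh_indexM a c).
Proof.
rewrite walsh_coef_sum; apply: eq_bigr => a _.
rewrite walsh_coef_sum (bigD1 (walsh_indexM a c)) //=.
rewrite walsh_coefZ walsh_coef_basis walsh_indexMK eqxx mulr1 big1 ?addr0 //.
move=> b nb; rewrite walsh_coefZ walsh_coef_basis.
rewrite (_ : _ == _ = false) ?mulr0 //; apply: contraNF nb => /eqP ->.
by rewrite walsh_indexMK.
Qed.

Lemma walsh_mulA : associative (@walsh_mul R n).
Proof.
move=> x y z; apply: walsh_coefP => c; rewrite !walsh_coefM.
under eq_bigr do rewrite walsh_coefM mulr_sumr.
under [RHS]eq_bigr do rewrite walsh_coefM mulr_suml.
rewrite [RHS]exchange_big /=; apply: eq_bigr => a _.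
rewrite (reindex_inj (inv_inj (walsh_indexMK a))) /=.
apply: eq_bigr => b _; rewrite mulrA; congr (_ * walsh_coef _ _).
by rewrite (walsh_indexMC a b) -walsh_indexMA walsh_indexMK.
Qed.

Lemma walsh_mulC : commutative (@walsh_mul R n).
Proof.
move=> x y; apply: walsh_coefP => c; rewrite !walsh_coefM.
rewrite (reindex_inj (inv_inj (walsh_indexMK c))) /=.
apply: eq_bigr => a _; rewrite mulrC; congr (_ * _); congr (walsh_coef _ _).
  by rewrite walsh_indexMC walsh_indexMK.
by rewrite walsh_indexMC.
Qed.

Lemma walsh_mul1 : left_id (walsh_basis R (walsh_index1 n)) (@walsh_mul R n).
Proof.
move=> x; apply: walsh_coefP => c.
rewrite walsh_coefM (bigD1 (walsh_index1 n)) //= walsh_coef_basis eqxx mul1r.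
rewrite walsh_index1M big1 ?addr0 // => a /negPf na.
by rewrite walsh_coef_basis na mul0r.
Qed.

Lemma walsh_mulDl : left_distributive (@walsh_mul R n) +%R.
Proof.
move=> x y z; apply: walsh_coefP => c.
rewrite walsh_coefD !walsh_coefM -big_split /=.
by apply: eq_bigr => a _; rewrite walsh_coefD mulrDl.
Qed.

Lemma walsh_1neq0 : walsh_basis R (walsh_index1 n) != 0 :> walsh R n.
Proof.
apply/eqP => /(congr1 (fun x : walsh R n => walsh_coef x (walsh_index1 n))).
by rewrite walsh_coef_basis eqxx /walsh_coef mxE; apply/eqP/oner_neq0.
Qed.

HB.instance Definition _ := GRing.Zmodule_isComNzRing.Build (walsh R n)
  walsh_mulA walsh_mulC walsh_mul1 walsh_mulDl walsh_1neq0.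

Lemma walsh_scaleAl (r : R) x y : r *: (x * y) = (r *: x) * y.
Proof.
apply: walsh_coefP => c; rewrite walsh_coefZ !walsh_coefM mulr_sumr.
by apply: eq_bigr => a _; rewrite walsh_coefZ mulrA.
Qed.

HB.instance Definition _ :=
  GRing.Lmodule_isLalgebra.Build R (walsh R n) walsh_scaleAl.
HB.instance Definition _ :=
  GRing.Lalgebra_isComAlgebra.Build R (walsh R n).

(* walsh R n is the tensor product of the U_k: the element p 1_k + q u_k of
   U_k is encoded by v : bool -> R with v false = p and v true = q, the basis
   vectors are the pure tensors of basis vectors, and the product is computed
   factorwise on pure tensors. *)
Definition walsh_factorM (v w : bool -> R) (c : bool) : R :=
  if c then v false * w true + v true * w false
  else v false * w false + v true * w true.

Definition walsh_tensor (v : 'I_n -> bool -> R) : walsh R n :=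
  \sum_(a : walsh_index n) (\prod_k v k (a k)) *: walsh_basis R a.

Lemma walsh_coef_tensor v a : walsh_coef (walsh_tensor v) a = \prod_k v k (a k).
Proof.
rewrite walsh_coef_sum (bigD1 a) //= walsh_coefZ walsh_coef_basis eqxx mulr1.
rewrite [X in _ + X]big1 ?addr0 // => b nb.
by rewrite walsh_coefZ walsh_coef_basis eq_sym (negPf nb) mulr0.
Qed.

Lemma walsh_tensor_basis a :
  walsh_tensor (fun k e => (e == a k)%:R) = walsh_basis R a.
Proof.
apply: walsh_coefP => b; rewrite walsh_coef_tensor walsh_coef_basis.
have [->|/eqP/ffunP nab] := eqVneq b a; first by rewrite big1 // => k; rewrite eqxx.
have [k /negPf nk] : exists k, b k != a k.
  by apply/existsP; apply: contra_notT nab => /existsPn H k; apply/eqP/negPn/H.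
by rewrite (bigD1 k) //= nk mul0r.
Qed.

Lemma walsh_tensor1 : walsh_tensor (fun _ e => (e == false)%:R) = 1.
Proof.
rewrite -[RHS](walsh_tensor_basis (walsh_index1 n)); congr walsh_tensor.
by apply/funext => k; apply/funext => e; rewrite ffunE.
Qed.

Lemma walsh_tensorM v w :
  walsh_tensor v * walsh_tensor w =
  walsh_tensor (fun k => walsh_factorM (v k) (w k)).
Proof.
apply: walsh_coefP => c; rewrite walsh_coefM walsh_coef_tensor.
transitivity (\prod_k \sum_(b : bool) v k b * w k (b (+) c k)).
  rewrite bigA_distr_bigA /=; apply: eq_bigr => a _.
  rewrite !walsh_coef_tensor -big_split /=.
  by apply: eq_bigr => k _; rewrite ffunE.
apply: eq_bigr => k _; rewrite big_bool /walsh_factorM /=.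
by case: (c k) => /=; rewrite addrC.
Qed.

End WalshAlgebra.

(* lin1_mx is the matrix of g |-> f * g acting on coordinate rows, i.e. the
   transpose of the usual one, which has the same characteristic polynomial. *)
Definition walsh_char_poly (R : realType) n (f : walsh R n) : {poly R} :=
  char_poly (lin1_mx ( *%R f : walsh R n -> walsh R n)).

Definition walsh_exp (R : realType) n (g : walsh R n) : walsh R n :=
  limn (series (fun k => (k`!%:R : R)^-1 *: g ^+ k)).

Section WalshExp.
Variables (R : realType) (n : nat).
Implicit Types (x y g : walsh R n).

Lemma walsh_norm_mul x y : `|x * y| <= (2 ^ n)%:R * `|x| * `|y|.
Proof.
have coef_le z (a : walsh_index n) : `|walsh_coef z a| <= `|z| :> R.
  rewrite [leRHS]mx_normrE.
  exact: (le_bigmax _ (fun ij => `|z ij.1 ij.2|) (0, enum_rank a)).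
rewrite [leLHS]mx_normrE; apply: bigmax_le => [|[i j] _].
  by rewrite !mulr_ge0.
rewrite /= ord1 -[j]enum_valK -/(walsh_coef _ _) walsh_coefM.
apply: le_trans (ler_norm_sum _ _ _) _.
apply: (@le_trans _ _ (\sum_(a : walsh_index n) `|x| * `|y|)).
  by apply: ler_sum => a _; rewrite normrM ler_pM.
by rewrite sumr_const card_walsh_index -mulrA mulr_natl.
Qed.

(* The limit in walsh_exp is a genuine one. *)
Lemma walsh_exp_cvg g :
  series (fun k => (k`!%:R : R)^-1 *: g ^+ k) @ \oo --> walsh_exp g.
Proof.
apply: normed_cvg.
set M := (2 ^ n)%:R * `|g|.
have leM k : `|g ^+ k| <= M ^+ k * `|1 : walsh R n|.
  elim: k => [|k IH]; first by rewrite !expr0 mul1r.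
  rewrite exprS (le_trans (walsh_norm_mul _ _)) // exprS -[leRHS]mulrA.
  by rewrite ler_wpM2l // mulr_ge0.
apply: (@series_le_cvg _ _ (`|1 : walsh R n| *: exp_coeff M)).
- by move=> k; rewrite normr_ge0.
- move=> k; rewrite /= /exp_coeff /= mulr_ge0 // divr_ge0 // exprn_ge0 //.
  by rewrite mulr_ge0.
- move=> k; rewrite /= normrZ normfV normr_nat.
  rewrite [leRHS](_ : _ = `|1 : walsh R n| * (M ^+ k / k`!%:R)) //.
  by rewrite mulrA [leRHS]mulrC ler_wpM2l ?invr_ge0 // mulrC.
by apply: is_cvg_seriesZ; exact: is_cvg_series_exp_coeff.
Qed.

End WalshExp.

(* Main.v *)
Require Import Defs.
From mathcomp Require Import all_boot all_order all_algebra.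
From mathcomp Require Import all_classical all_reals all_analysis.
Import Order.TTheory GRing.Theory Num.Theory.
Local Open Scope ring_scope.

(** Multiplication operators on the Walsh algebra are simultaneously
    diagonalisable.  In each factor [U_k] the two elements [(1 + u_k) / 2] and
    [(1 - u_k) / 2] are orthogonal idempotents with sum [1]; their pure tensors
    [walsh_idem s], indexed by the choices of signs [s], are [2 ^ n] orthogonal
    idempotents with sum [1] in the whole algebra ([walsh_idemM],
    [walsh_idem_sum]).  Each of them is an eigenvector of multiplication by any
    [f] ([mul_walsh_idem]), with an eigenvalue [walsh_eigenvalue f s], so that
    [f] is the combination of the idempotents with these coefficients
    ([walsh_spectral]) and every coefficient is a root of the characteristic
    polynomial ([root_walsh_char_poly]).

    Because powers of a combination of the idempotents are computed
    coefficientwise, so is the exponential ([walsh_exp_idem]).  When all the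
    eigenvalues of [f] are positive, the combination of the idempotents whose
    coefficients are the logarithms of these eigenvalues is therefore a
    logarithm of [f]. *)

Section SpectralDecomposition.
Context {R : realType} {n : nat}.
Implicit Types (f : walsh R n) (a s t : walsh_index n) (l : walsh_index n -> R).

Definition walsh_idem s : walsh R n :=
  walsh_tensor (fun k e => (-1) ^+ (e && s k) / 2).

Definition walsh_eigenvalue f s : R :=
  \sum_a walsh_coef f a * \prod_k (-1) ^+ (a k && s k).

Lemma walsh_expansion f : f = \sum_a walsh_coef f a *: walsh_basis R a.
Proof.
apply: walsh_coefP => b; rewrite walsh_coef_sum (bigD1 b) //=.
rewrite walsh_coefZ walsh_coef_basis eqxx mulr1 big1 ?addr0 // => a nab.
by rewrite walsh_coefZ walsh_coef_basis eq_sym (negPf nab) mulr0.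
Qed.

(** Factorwise this is [u * (1 + c u) / 2 = c (1 + c u) / 2] for [c = 1] or
    [c = -1]. *)
Lemma walsh_basisM_idem a s :
  walsh_basis R a * walsh_idem s =
  (\prod_k (-1) ^+ (a k && s k)) *: walsh_idem s.
Proof.
rewrite /walsh_idem -walsh_tensor_basis walsh_tensorM; apply: walsh_coefP => c.
rewrite walsh_coefZ !walsh_coef_tensor -big_split /=; apply: eq_bigr => k _.
rewrite /walsh_factorM; case: (c k); case: (a k); case: (s k);
  by rewrite /= ?expr0 ?expr1 ?mul0r ?mul1r ?addr0 ?add0r ?mulN1r ?mulNr
             ?mul1r ?opprK.
Qed.

Lemma mul_walsh_idem f s : f * walsh_idem s = walsh_eigenvalue f s *: walsh_idem s.
Proof.
rewrite [in LHS](walsh_expansion f) mulr_suml scaler_suml.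
by apply: eq_bigr => a _; rewrite -scalerAl walsh_basisM_idem scalerA.
Qed.

(** Expanding the product over [k] of [(1 + u_k) / 2 + (1 - u_k) / 2 = 1]. *)
Lemma walsh_idem_sum : \sum_s walsh_idem s = 1.
Proof.
rewrite -walsh_tensor1; apply: walsh_coefP => c.
rewrite walsh_coef_sum walsh_coef_tensor.
under [LHS]eq_bigr do rewrite /walsh_idem walsh_coef_tensor.
rewrite -(bigA_distr_bigA (fun k (b : bool) => (-1) ^+ (c k && b) / 2)) /=.
apply: eq_bigr => k _; rewrite big_bool; case: (c k) => /=.
  by rewrite expr0 expr1 mulNr addNr.
by rewrite expr0 -splitr.
Qed.

(** At an index where the signs differ, the two factors are [(1 + u) / 2] and
    [(1 - u) / 2], whose product is zero. *)
Lemma walsh_idemM s t : walsh_idem s * walsh_idem t = (s == t)%:R *: walsh_idem t.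
Proof.
rewrite /walsh_idem walsh_tensorM; apply: walsh_coefP => c.
rewrite walsh_coefZ !walsh_coef_tensor.
have [->|nst] := eqVneq s t.
  rewrite mul1r; apply: eq_bigr => k _; rewrite /walsh_factorM /=.
  have h : 2^-1 * 2^-1 + 2^-1 * 2^-1 = 2^-1 :> R.
    by rewrite -mulrDl -[in RHS](mul1r (2^-1)) [X in _ = X * _](splitr 1) !mul1r.
  case: (c k); case: (t k); rewrite /= ?expr0 ?expr1 ?mul1r ?mulN1r ?mulrNN //.
  by rewrite mulrN mulNr -opprD h.
have [k nk] : exists k, s k != t k.
  apply/existsP; apply: contraNT nst => /existsPn H.
  by apply/eqP/ffunP => k; apply/eqP/negPn/H.
rewrite mul0r (bigD1 k) //= [X in X * _](_ : _ = 0) ?mul0r //.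
rewrite /walsh_factorM; case: (c k); move: nk; case: (s k); case: (t k) => //= _;
  by rewrite ?expr0 ?expr1 ?mul1r ?mulN1r ?mulrN ?mulNr ?addNr ?addrN.
Qed.

Lemma walsh_idem_neq0 s : walsh_idem s != 0.
Proof.
apply/eqP => /(congr1 (fun x => walsh_coef x (walsh_index1 n))).
rewrite walsh_coef_tensor [RHS]mxE; apply/eqP/prodf_neq0 => k _.
by rewrite ffunE expr0 mul1r invr_eq0 pnatr_eq0.
Qed.

Lemma walsh_spectral f : f = \sum_s walsh_eigenvalue f s *: walsh_idem s.
Proof.
rewrite -[LHS]mulr1 -walsh_idem_sum mulr_sumr.
by apply: eq_bigr => s _; rewrite mul_walsh_idem.
Qed.

(** The idempotent [walsh_idem s] is a nonzero eigenvector of multiplication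
    by [f]. *)
Lemma root_walsh_char_poly f s : root (walsh_char_poly f) (walsh_eigenvalue f s).
Proof.
rewrite /walsh_char_poly -eigenvalue_root_char; apply/eigenvalueP.
exists (walsh_idem s); last exact: walsh_idem_neq0.
rewrite -mul_walsh_idem.
(* Composing with the identity gives multiplication by [f] its linear structure. *)
exact: (mul_rV_lin1 (f \*o idfun : {linear walsh R n -> walsh R n})).
Qed.

Lemma walsh_idem_combX l k :
  (\sum_s l s *: walsh_idem s) ^+ k = \sum_s l s ^+ k *: walsh_idem s.
Proof.
elim: k => [|k IH].
  by rewrite expr0 -walsh_idem_sum; apply: eq_bigr => s _; rewrite scale1r.
rewrite exprS IH mulr_sumr; apply: eq_bigr => t _.
rewrite -scalerAr mulr_suml (bigD1 t) //= -scalerAl walsh_idemM eqxx scale1r.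
rewrite big1 ?addr0 ?scalerA -?exprSr // => s /negPf nst.
by rewrite -scalerAl walsh_idemM nst scale0r scaler0.
Qed.

(** Each partial sum of the exponential series is the combination of the
    idempotents whose coefficients are the partial sums of the real series. *)
Lemma walsh_exp_idem l :
  walsh_exp (\sum_s l s *: walsh_idem s) = \sum_s expR (l s) *: walsh_idem s.
Proof.
rewrite /walsh_exp.
rewrite (_ : series _ = (fun N => \sum_s series (exp_coeff (l s)) N *: walsh_idem s)).
  apply: cvg_lim => //; apply: cvg_big => [|s _]; first exact: add_continuous.
  by apply: cvgZr_tmp; exact: is_cvg_series_exp_coeff.
apply/funext => N; rewrite /series /=.
under [RHS]eq_bigr do rewrite scaler_suml.
rewrite exchange_big /=; apply: eq_bigr => k _.
rewrite walsh_idem_combX scaler_sumr; apply: eq_bigr => s _.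
by rewrite scalerA /exp_coeff /= mulrC.
Qed.

End SpectralDecomposition.

Theorem mainTheorem6 (R : realType) (n : nat) (hn : (1 <= n)%N)
    (f : walsh R n)
    (hf : forall x : R, root (walsh_char_poly f) x -> 0 < x) :
  exists g : walsh R n, f = walsh_exp g.
Proof.
exists (\sum_s ln (walsh_eigenvalue f s) *: walsh_idem s).
rewrite walsh_exp_idem [LHS]walsh_spectral; apply: eq_bigr => s _.
by rewrite lnK // posrE hf // root_walsh_char_poly.
Qed.
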